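(* Let $(\alpha_n(a,k,q),\beta_n(a,k,q))_{n\ge0}$ satisfy, for all parameters $a,k$, all bases $q$, and all $n\ge0$, \[ \beta_{n}(a,k,q) = \sum_{j=0}^{n}\frac{(k/a;q)_{n-j}(k;q)_{n+j}}{(q;q)_{n-j}(aq;q)_{n+j}}\alpha_{j}(a,k,q). \] Let $(g_n)$ be an arbitrary sequence and $e,c$ arbitrary constants. Define $\alpha_n'(a,k,q^2) = g_n\alpha_n(e,c,q)$ and \[ \beta_{n}'(a,k,q^2)= \sum_{j=0}^{n}\beta_{j}(e,c,q)\frac{(1-c q^{2j})(k/a;q^2)_{n-j}(k;q^2)_{n+j}(eq;q)_{2j}}{(1-c)(q^2;q^2)_{n-j}(aq^2;q^2)_{n+j}(cq;q)_{2j}} \sum_{r=0}^{n-j}\frac{(1-eq^{2j+2r})(q^{-2(n-j)},kq^{2n+2j};q^2)_r(e/c,eq^{2j};q)_r\, g_{r+j}}{(1-e q^{2j})(a q^{2n+2j+2},a q^{2-2(n-j)}/k;q^2)_r(cq^{2j+1},q;q)_r}\left(\frac{q^2 c a}{k e}\right)^r. \] Then $(\alpha_n'(a,k,q^2),\beta_n'(a,k,q^2))$ satisfies the relation in base $q^2$: $\beta_n'(a,k,q^2)=\sum_{j=0}^{n}\frac{(k/a;q^2)_{n-j}(k;q^2)_{n+j}}{(q^2;q^2)_{n-j}(aq^2;q^2)_{n+j}}\alpha_j'(a,k,q^2)$ for all $n\ge0$.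
   Context: $(x;q)_n=\prod_{i=0}^{n-1}(1-xq^i)$, $(x_1,\dots,x_m;q)_n=\prod_i(x_i;q)_n$. Parameters are generic so denominators are nonzero. *)

(* Defs.v *)
From mathcomp Require Import all_boot all_algebra.
Set Implicit Arguments.
Unset Strict Implicit.
Unset Printing Implicit Defensive.
Import GRing.Theory.
Local Open Scope ring_scope.

(* (x;q)_n *)
Definition qpoch (F : fieldType) (x q : F) (n : nat) : F :=
  \prod_(i < n) (1 - x * q ^+ i).

(* (x_1,...,x_m;q)_n *)
Definition qpochs (F : fieldType) (xs : seq F) (q : F) (n : nat) : F :=
  \prod_(x <- xs) qpoch x q n.

Definition wp_bailey_relation (F : fieldType) (a k q : F)
    (alpha beta : nat -> F) : Prop :=
  forall n : nat,
    beta n =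
    \sum_(j < n.+1)
      (qpoch (k / a) q (n - j) * qpoch k q (n + j)) /
      (qpoch q q (n - j) * qpoch (a * q) q (n + j)) * alpha j.

(* No denominator of [wp_bailey_relation a k q] vanishes, for any n. *)
Definition wp_bailey_generic (F : fieldType) (a q : F) : Prop :=
  [/\ a != 0,
      forall m, qpoch q q m != 0
    & forall m, qpoch (a * q) q m != 0].

(* [alpha'] and [beta'] are the new sequences at the parameters (a, k, q^2).
   They take q itself as argument, since it is not determined by q^2;
   [alpha'] does not depend on a and k. *)
Definition alpha' (F : fieldType) (alpha : nat -> F -> F -> F -> F)
    (g : nat -> F) (e c q : F) (n : nat) : F :=
  g n * alpha n e c q.

Definition beta' (F : fieldType) (beta : nat -> F -> F -> F -> F)
    (g : nat -> F) (e c a k q : F) (n : nat) : F :=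
  \sum_(j < n.+1)
    beta j e c q *
    (((1 - c * q ^+ (2 * j)) * qpoch (k / a) (q ^+ 2) (n - j) *
      qpoch k (q ^+ 2) (n + j) * qpoch (e * q) q (2 * j)) /
     ((1 - c) * qpoch (q ^+ 2) (q ^+ 2) (n - j) *
      qpoch (a * q ^+ 2) (q ^+ 2) (n + j) * qpoch (c * q) q (2 * j))) *
    \sum_(r < (n - j).+1)
      ((1 - e * q ^+ (2 * j + 2 * r)) *
       qpochs [:: q ^- (2 * (n - j)); k * q ^+ (2 * n + 2 * j)] (q ^+ 2) r *
       qpochs [:: e / c; e * q ^+ (2 * j)] q r * g (r + j)%N) /
      ((1 - e * q ^+ (2 * j)) *
       qpochs [:: a * q ^+ (2 * n + 2 * j + 2);
                  a * (q ^+ 2 / q ^+ (2 * (n - j))) / k] (q ^+ 2) r *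
       qpochs [:: c * q ^+ (2 * j + 1); q] q r) *
      ((q ^+ 2 * c * a) / (k * e)) ^+ r.

(* Main.v *)
Require Import Defs.
From mathcomp Require Import all_boot all_algebra.
From mathcomp Require Import ring.
Import GRing.Theory.
Local Open Scope ring_scope.

(* The WP-Bailey relation is triangular and can be inverted: alpha_n is the sum
   of M(n, j) beta_j over j <= n for an explicit kernel M.  Orthogonality of M
   with the original kernel L is a summation that telescopes.  In beta', setting
   s = r + j and reversing the shifted factorials of base q^2 that involve
   n - j, the summand becomes
     L(n, s; a, k, q^2) g_s M(s, j; e, c, q) beta_j(e, c, q),
   so summing over j first produces L(n, s) g_s alpha_s(e, c, q). *)

Lemma triangular_exchange_big (V : nmodType) (n : nat) (f : nat -> nat -> V) :
  \sum_(j < n.+1) \sum_(i < j.+1) f j i =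
  \sum_(i < n.+1) \sum_(r < (n - i).+1) f (i + r)%N i.
Proof.
elim: n => [|n IHn]; first by rewrite !big_ord1.
rewrite big_ord_recr [RHS]big_ord_recr /= subnn big_ord1 addn0 IHn.
rewrite [X in _ + X]big_ord_recr /= addrA -big_split /=; congr (_ + _).
apply: eq_bigr => i _; rewrite subSn -1?ltnS // [RHS]big_ord_recr /=.
by rewrite addnS subnKC // -ltnS.
Qed.

(** * Shifted factorials: splitting and reversal *)

Section QPochhammer.
Context {F : fieldType}.
Implicit Types (x y q : F) (m n r : nat).

Lemma qpoch0 x q : qpoch x q 0 = 1.
Proof. by rewrite /qpoch big_ord0. Qed.

Lemma qpochS x q n : qpoch x q n.+1 = qpoch x q n * (1 - x * q ^+ n).
Proof. by rewrite /qpoch big_ord_recr. Qed.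

Lemma qpochD x q m n :
  qpoch x q (m + n) = qpoch x q m * qpoch (x * q ^+ m) q n.
Proof.
elim: n => [|n IHn]; first by rewrite addn0 qpoch0 mulr1.
by rewrite addnS !qpochS IHn exprD !mulrA.
Qed.

Lemma qpochSl x q n : qpoch x q n.+1 = (1 - x) * qpoch (x * q) q n.
Proof. by rewrite -add1n qpochD qpochS qpoch0 mul1r expr0 mulr1 expr1. Qed.

Lemma qpochs2 x y q n : qpochs [:: x; y] q n = qpoch x q n * qpoch y q n.
Proof. by rewrite /qpochs big_cons big_seq1. Qed.

(** Since 1 - y q^i = -y q^i (1 - 1/(y q^i)), reading the factors from last to first gives a shifted
    factorial starting at 1/(y q^(n-1)). The product of the q^i stays unevaluated, as it cancels in
    ratios. *)
Lemma qpoch_rev y q n : q != 0 -> y != 0 ->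
  qpoch y q n =
  qpoch (q / (y * q ^+ n)) q n * (- y) ^+ n * \prod_(i < n) q ^+ i.
Proof.
move=> q0 y0; elim: n => [|n IHn]; first by rewrite !qpoch0 big_ord0 !mulr1.
rewrite qpochS IHn qpochSl big_ord_recr /= (exprS (- y)).
have -> : q / (y * q ^+ n.+1) = (y * q ^+ n)^-1.
  by rewrite exprS; field; rewrite q0 y0 expf_neq0.
have -> : (y * q ^+ n)^-1 * q = q / (y * q ^+ n) by rewrite mulrC.
have := expf_neq0 n q0; move: (\prod_(i < n) _) (qpoch _ _ _) => p u.
by move: (q ^+ n) (_ ^+ n) => Q v Q0; field; rewrite y0 Q0.
Qed.

(** * The terminating sum behind orthogonality *)

Section Orthogonality.
Variables (b E q : F).
Hypotheses (b0 : b != 0) (q0 : forall m, qpoch q q m != 0).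
Hypotheses (Eq0 : forall m, qpoch (E * q) q m != 0).
Hypotheses (Aq0 : forall m, qpoch (b * E * q) q m != 0).

(** What remains of M(i + N, i + t) L(i + t, i) for b = k/a and E = a q^(2i), once the factors
    independent of t are removed. *)
Let term N t :=
  (1 - b * E * q ^+ (2 * t)) *
  (qpoch b^-1 q (N - t) * qpoch E q (N + t) * b ^+ (N - t)) /
  (qpoch q q (N - t) * qpoch (b * E * q) q (N + t)) *
  (qpoch b q t * qpoch (b * E) q t) / (qpoch q q t * qpoch (E * q) q t).

Lemma sub1_exp_neq0 m : 1 - q ^+ m.+1 != 0.
Proof. by have := q0 m.+1; rewrite qpochS mulf_eq0 exprS => /norP[]. Qed.

(* The sum is a very-well-poised 6-phi-5 with base parameter A = b E and
   numerator parameters b, E q^N, q^-N, whose product is A; this is the case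
   in which the partial sums have a closed form.  The negative powers of q have
   been cleared, so that b may itself be a power of q. *)
Lemma wp_partial_sum N T : (0 < N)%N -> (T <= N)%N ->
  \sum_(t < T.+1) term N t =
  qpoch (b * E) q T.+1 * qpoch (b * q) q T * qpoch E q (N + T).+1 *
  (qpoch b^-1 q (N - T) * b ^+ (N - T)) * (1 - q ^+ (N - T)) /
  (qpoch q q T * qpoch (E * q) q T * qpoch (b * E * q) q (N + T) *
   qpoch q q (N - T)) / ((1 - q ^+ N) * (1 - E * q ^+ N)).
Proof.
case: N => // N _.
have qN0 := sub1_exp_neq0 N.
have EN0 : 1 - E * q ^+ N.+1 != 0.
  by have := Eq0 N.+1; rewrite qpochS mulf_eq0 -mulrA -exprS => /norP[].
elim: T => [_|T IHT leTN].
  rewrite big_ord1 /term !addn0 subn0 muln0 !qpoch0 !(qpochS _ _ 0) !qpoch0.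
  rewrite expr0 (qpochS E _ N.+1).
  have := q0 N.+1; have := Aq0 N.+1.
  move: (qpoch _ _ _) (qpoch _ _ _) (qpoch _ _ _) (qpoch _ _ _) qN0 EN0.
  move: (q ^+ _) => Q A B C D qN0 EN0 A0 B0.
  by field; rewrite A0 B0 qN0 EN0 oner_neq0.
(* Writing the upper index as T + 1 + m removes truncated subtraction. With the factorials
   abstracted, the induction step is a rational identity in which T and m enter only through q^T,
   q^m and b^m. *)
have [m Dm] : exists m, N.+1 = (T.+1 + m)%N.
  by exists (N.+1 - T.+1)%N; rewrite subnKC.
rewrite big_ord_recr /= IHT ?(ltnW leTN) //.
have [-> ->] : (N.+1 - T = m.+1)%N /\ (N.+1 - T.+1 = m)%N.
  by rewrite Dm addKn addSnnS addKn.
rewrite /term; have -> : (N.+1 - T.+1 = m)%N by rewrite Dm addKn.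
rewrite (qpochSl b) (qpochS (b * E) _ T.+1) (qpochS (b * q)).
rewrite addnS (qpochS E _ (N.+1 + T).+1).
rewrite (qpochS b^-1) (qpochS (b * E * q)) (qpochS q q T) (qpochS (E * q)).
rewrite (qpochS q q m).
have qm0 := sub1_exp_neq0 m; have qT0 := sub1_exp_neq0 T.
have ET0 : 1 - E * q ^+ T.+1 != 0.
  by have := Eq0 T.+1; rewrite qpochS mulf_eq0 -mulrA -exprS => /norP[].
have AT0 : 1 - b * E * q ^+ (N.+1 + T).+1 != 0.
  have := Aq0 (N.+1 + T).+1.
  by rewrite qpochS mulf_eq0 -[_ * q * _]mulrA -exprS => /norP[].
have := q0 T; have := Eq0 T; have := Aq0 (N.+1 + T); have := q0 m.
move: (qpoch (b * E) _ _) (qpoch (b * q) _ _) (qpoch E _ _) (qpoch b^-1 _ _).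
move=> p1 p2 p3 p4; move: (qpoch q q m) (qpoch _ _ (N.+1 + T)).
move: (qpoch _ _ T) (qpoch _ _ T) => p5 p6 p7 p8 p70 p80 p60 p50.
move: qN0 EN0 qm0 qT0 ET0 AT0.
have e1 : (N.+1 + T).+1 = (T + m + T).+2 by rewrite Dm !addSn.
rewrite {}e1 mul2n -addnn {}Dm !(addSn, addnS) !exprS !exprD.
move: (q ^+ T) (q ^+ m) (b ^+ m) => x y z; rewrite -!mulrA => ? ? ? ? ? ?.
by field; do !(apply/andP; split).
Qed.

Lemma wp_orthogonal N : (0 < N)%N -> \sum_(t < N.+1) term N t = 0.
Proof. by move=> N0; rewrite wp_partial_sum // subnn subrr mulr0 !mul0r. Qed.

End Orthogonality.

(** * The kernel L and its inverse M *)

Definition wp_coef (a k q : F) n j : F :=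
  (qpoch (k / a) q (n - j) * qpoch k q (n + j)) /
  (qpoch q q (n - j) * qpoch (a * q) q (n + j)).

(** This is [wp_coef] with a and k exchanged, multiplied by (k/a)^(n-j) and by two very-well-poised
    factors. *)
Definition wp_inv_coef (a k q : F) n j : F :=
  (1 - a * q ^+ (2 * n)) / (1 - a) * ((1 - k * q ^+ (2 * j)) / (1 - k)) *
  (qpoch (a / k) q (n - j) * qpoch a q (n + j) * (k / a) ^+ (n - j) /
   (qpoch q q (n - j) * qpoch (k * q) q (n + j))).

Section Inversion.
Variables (a k q : F).
Hypotheses (k0 : k != 0) (k1 : 1 - k != 0) (gen : wp_bailey_generic a q).
Hypotheses (a10 : 1 - a != 0).
Hypotheses (kq0 : forall m, qpoch (k * q) q m != 0).

(** Splitting the factorials at 2i reduces the entry of M L in row i + N and column i to the sum of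
    [wp_orthogonal], where b E = k q^(2i). It vanishes off the diagonal. *)
Lemma wp_inv_coefK i N :
  \sum_(t < N.+1) wp_inv_coef a k q (i + N) (i + t) * wp_coef a k q (i + t) i =
  (N == 0)%:R.
Proof.
have [a0 q0 aq0] := gen.
have kak : k / a * (a * q ^+ (2 * i)) = k * q ^+ (2 * i) by field.
have aq_split m : qpoch (a * q) q (i + i + m) =
    qpoch (a * q) q (2 * i) * qpoch (a * q ^+ (2 * i) * q) q m.
  by rewrite addnn -mul2n qpochD mulrAC.
have kq_split m : qpoch (k * q) q (i + i + m) =
    qpoch (k * q) q (2 * i) * qpoch (k * q ^+ (2 * i) * q) q m.
  by rewrite addnn -mul2n qpochD mulrAC.
have aq_tail m : qpoch (a * q ^+ (2 * i) * q) q m != 0.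
  by have := aq0 (i + i + m)%N; rewrite aq_split mulf_eq0 => /norP[].
have kq_tail m : qpoch (k * q ^+ (2 * i) * q) q m != 0.
  by have := kq0 (i + i + m)%N; rewrite kq_split mulf_eq0 => /norP[].
pose b := k / a; pose E := a * q ^+ (2 * i).
transitivity ((1 - a * q ^+ (2 * (i + N))) / (1 - a) / (1 - k) *
    (qpoch a q (2 * i) * qpoch k q (2 * i)) /
    (qpoch (k * q) q (2 * i) * qpoch (a * q) q (2 * i)) *
  \sum_(t < N.+1) (1 - b * E * q ^+ (2 * t)) *
  (qpoch b^-1 q (N - t) * qpoch E q (N + t) * b ^+ (N - t)) /
  (qpoch q q (N - t) * qpoch (b * E * q) q (N + t)) *
  (qpoch b q t * qpoch (b * E) q t) / (qpoch q q t * qpoch (E * q) q t)).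
  rewrite mulr_sumr; apply: eq_bigr => -[t /= ltN] _.
  rewrite /wp_inv_coef /wp_coef /b /E invf_div kak subnDl addKn.
  have -> : (i + N + (i + t) = i + i + (N + t))%N by rewrite addnACA.
  have -> : (i + t + i = i + i + t)%N by rewrite addnAC.
  rewrite aq_split kq_split addnn -mul2n !(qpochD _ _ (2 * i)).
  have := aq_tail t; have := kq_tail (N + t)%N.
  have := q0 t; have := q0 (N - t)%N.
  have := aq0 (2 * i)%N; have := kq0 (2 * i)%N.
  rewrite [(2 * (i + t))%N]mulnDr exprD mulrA.
  move: (qpoch _ _ _) (qpoch _ _ _) (qpoch _ _ _) (qpoch _ _ _).
  move=> p1 p2 p3 p4 p40 p30 p20 p10 tail1 tail2; field.
  by rewrite ?mulrA ?a0 ?a10 ?k1 ?p10 ?p20 ?p30 ?p40 ?tail1 ?tail2.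
have [->|N0] := posnP N; last first.
  by rewrite wp_orthogonal ?mulr0 ?mulf_neq0 ?invr_neq0 // => m; rewrite kak.
rewrite big_ord1 /b /E kak !addn0 subnn !qpoch0 muln0 expr0.
rewrite !mulr1.
(* On the diagonal, peeling (x;q)_(2i+1) at either end gives (1 - x) (xq;q)_(2i) = (x;q)_(2i) (1 - x
   q^(2i)), for x = a and x = k. *)
have := qpochS a q (2 * i); rewrite qpochSl.
have := qpochS k q (2 * i); rewrite qpochSl.
have := aq0 (2 * i)%N; have := kq0 (2 * i)%N.
move: (qpoch _ _ _) (qpoch _ _ _) (qpoch _ _ _) (qpoch _ _ _).
move: (q ^+ _) => x p1 p2 p3 p4 p40 p30 k_eq a_eq.
transitivity ((p1 * (1 - a * x)) * (p2 * (1 - k * x)) /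
              (((1 - a) * p3) * ((1 - k) * p4))).
  by field; rewrite a10 k1 p30 p40 oner_neq0.
by rewrite -a_eq -k_eq divff // !mulf_neq0.
Qed.

Lemma wp_bailey_inversion (alpha beta : nat -> F) :
  wp_bailey_relation a k q alpha beta ->
  forall n, alpha n = \sum_(j < n.+1) wp_inv_coef a k q n j * beta j.
Proof.
move=> rel n; under eq_bigr => j _ do rewrite rel mulr_sumr.
rewrite (triangular_exchange_big _ n
  (fun j i => wp_inv_coef a k q n j * (wp_coef a k q j i * alpha i))).
transitivity (\sum_(i < n.+1) (n - i == 0)%N%:R * alpha i).
  rewrite big_ord_recr /= subnn mul1r big1 ?add0r // => i _.
  by rewrite subn_eq0 leqNgt ltn_ord mul0r.
apply: eq_bigr => -[i /= lein] _.
rewrite -(wp_inv_coefK i) subnKC -1?ltnS // mulr_suml.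
by apply: eq_bigr => t _; rewrite mulrA.
Qed.

End Inversion.

(** Reversing the last r factors of both (k/a;q)_(m+r) and (q;q)_(m+r) produces the factorials
    starting at negative powers of q; the leftover powers combine to (qa/k)^r. *)
Lemma qpoch_reversed_ratio (a k q : F) m r : q != 0 -> a != 0 -> k != 0 ->
  qpoch (a * (q / q ^+ (m + r)) / k) q r != 0 ->
  qpoch q q (m + r) != 0 ->
  qpoch (k / a) q (m + r) / qpoch q q (m + r) *
  (qpoch (q ^- (m + r)) q r / qpoch (a * (q / q ^+ (m + r)) / k) q r) *
  (q * a / k) ^+ r = qpoch (k / a) q m / qpoch q q m.
Proof.
move=> q0 a0 k0 den0; have qm0 : q ^+ m != 0 by rewrite expf_neq0.
have qr0 : q ^+ r != 0 by rewrite expf_neq0.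
have ka0 : k / a * q ^+ m != 0 by rewrite !mulf_neq0 ?invr_neq0.
have qq0 : q * q ^+ m != 0 by rewrite mulf_neq0.
rewrite !(qpochD _ _ m r) (qpoch_rev _ _ _ q0 ka0) (qpoch_rev _ _ _ q0 qq0).
have -> : q / (k / a * q ^+ m * q ^+ r) = a * (q / q ^+ (m + r)) / k.
  by rewrite exprD; field; rewrite a0 k0 qm0 qr0.
have -> : q / (q * q ^+ m * q ^+ r) = q ^- (m + r).
  by rewrite exprD; field; rewrite q0 qm0 qr0.
have -> : (- (q * q ^+ m)) ^+ r = (- (k / a * q ^+ m)) ^+ r * (q * a / k) ^+ r.
  by rewrite -exprMn; congr (_ ^+ _); field; rewrite a0 k0.
(* The hypothesis on (q;q)_(m+r), rewritten along with the goal, also shows that the factors to be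
   cancelled are nonzero. *)
rewrite !mulf_eq0 !negb_or => /andP[y30 /andP[/andP[y10 /andP[v0 u0]] p0]].
by field; rewrite den0 y30 y10 v0 u0 p0.
Qed.

End QPochhammer.

(** * The passage from base q to base q^2 *)

Theorem theorem3p3 (F : fieldType)
  (alpha beta : nat -> F -> F -> F -> F)
  (Hpair : forall a k q : F, wp_bailey_generic a q ->
     wp_bailey_relation a k q (fun n => alpha n a k q) (fun n => beta n a k q))
  (g : nat -> F) (e c a k q : F)
  (q_neq0 : q != 0) (k_neq0 : k != 0) (c_neq0 : c != 0) (c_neq1 : 1 - c != 0)
  (Heq : wp_bailey_generic e q)
  (Haq2 : wp_bailey_generic a (q ^+ 2))
  (He : forall j : nat, 1 - e * q ^+ (2 * j) != 0)
  (Hc : forall m : nat, qpoch (c * q) q m != 0)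
  (Hak : forall m : nat,
     qpoch (a * (q ^+ 2 / q ^+ (2 * m)) / k) (q ^+ 2) m != 0) :
  wp_bailey_relation a k (q ^+ 2)
    (alpha' alpha g e c q) (beta' beta g e c a k q).
Proof.
have [e_neq0 q_gen eq_gen] := Heq; have [a_neq0 q2_gen aq2_gen] := Haq2.
have e_neq1 : 1 - e != 0 by have := He 0; rewrite muln0 expr0 mulr1.
move=> n; rewrite /beta' /alpha'.
under [RHS]eq_bigr => s _.
  rewrite (wp_bailey_inversion _ _ _ c_neq0 c_neq1 Heq e_neq1 Hc _ _
    (Hpair _ c _ Heq)).
  rewrite !mulr_sumr.
  over.
rewrite (triangular_exchange_big _ n (fun s j => wp_coef a k (q ^+ 2) n s *
  (g s * (wp_inv_coef e c q s j * beta j e c q)))).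
apply: eq_bigr => -[j /= lejn] _; rewrite mulr_sumr.
apply: eq_bigr => -[r /= lern] _.
(* Here m = n - s with s = j + r. *)
have [m Dnj] : exists m, (n - j = m + r)%N.
  by exists (n - j - r)%N; rewrite subnK.
rewrite !qpochs2 Dnj /wp_coef /wp_inv_coef addKn.
have -> : (n - (j + r) = m)%N by rewrite subnDA Dnj addnK.
have -> : (n + (j + r) = n + j + r)%N by rewrite addnA.
have -> : (j + r + j = 2 * j + r)%N by rewrite addnAC mul2n addnn.
rewrite -!mulnDr addnC.
have -> : a * q ^+ (2 * (n + j) + 2) = a * q ^+ 2 * (q ^+ 2) ^+ (n + j).
  by rewrite exprD mulrCA mulrC -exprM.
have -> : c * q ^+ (2 * j + 1) = c * q * q ^+ (2 * j).
  by rewrite addn1 exprS mulrA.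
(* The first power is absorbed by the reversal in base q^2; the second is the power in M(s, j; e, c,
   q). *)
have -> : (q ^+ 2 * c * a / (k * e)) ^+ r =
    (q ^+ 2 * a / k) ^+ r * (c / e) ^+ r.
  by rewrite -exprMn; congr (_ ^+ _); field; rewrite e_neq0 k_neq0.
have q2_neq0 : q ^+ 2 != 0 by rewrite expf_neq0.
(* The first r of these m + r factors form the denominator in the inner sum. *)
have := Hak (m + r)%N; rewrite (addnC m r) qpochD addnC.
rewrite !(exprM q 2 (m + r)) (exprM q 2 (n + j)) mulf_eq0 => /norP[ak_neq0 _].
rewrite -[X in _ = X * _]mulf_div.
rewrite -(qpoch_reversed_ratio _ _ _ m r q2_neq0 a_neq0 k_neq0 ak_neq0) //.
(* This splits the factorial of M into the (eq;q)_(2j) of the outer sum and the factors 1/(1 - e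
   q^(2j)) and (e q^(2j);q)_r of the inner one. *)
have -> : qpoch e q (2 * j + r) =
   (1 - e) * qpoch (e * q) q (2 * j) / (1 - e * q ^+ (2 * j)) *
   qpoch (e * q ^+ (2 * j)) q r.
  by rewrite qpochD -qpochSl qpochS mulfK.
have := aq2_gen (n + j + r)%N; have := Hc (2 * j + r)%N.
rewrite !(qpochD _ _ (n + j) r) !(qpochD _ _ (2 * j) r).
rewrite !mulf_eq0 => /norP[c1 c2] /norP[a1 a2].
rewrite (addnC r j); move: ((q ^+ 2 * a / k) ^+ r) ((c / e) ^+ r) => z w.
by field; rewrite c1 c2 a1 a2 ak_neq0 q_gen q2_gen He c_neq1 e_neq1.
Qed.
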